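(* For integers $a,b>1$, the $a\times b$ grid graph is a graph of stably matchable pairs if and only if $ab$ is even and $\min\{a,b\}\ne 3$.
   Context: The $a\times b$ grid graph has vertex set $\{(i,j)\in\mathbb{Z}^2: 0\le i<a,\ 0\le j<b\}$, with two vertices adjacent when their Euclidean distance is $1$. A stable matching instance consists of finite disjoint sets of students and residencies, where each student has a strict linear preference order on a subset of the residencies and each residency has a strict linear preference order on a subset of the students. A matching (set of student–residency pairs, each element in at most one pair) is stable if each of its pairs is mutually acceptable (each member appears in the other's list) and no mutually acceptable pair $(s,r)$ not in it has both $s$ unmatched or preferring $r$ to its partner and $r$ unmatched or preferring $s$ to its partner. The graph of stably matchable pairs of the instance is the bipartite graph whose vertices are all students and residencies and whose edges are the pairs occurring in at least one stable matching. A graph is a graph of stably matchable pairs if it is isomorphic to the graph of stably matchable pairs of some stable matching instance. *)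

(* Defs.v *)
From HB Require Import structures.
From mathcomp Require Import all_boot all_order all_algebra.
From mathcomp Require Import realalg.

Set Implicit Arguments.
Unset Strict Implicit.
Unset Printing Implicit Defensive.

(* A strict linear order on a subset is encoded as the duplicate-free list of
   that subset, most preferred element first. *)
Record instance := Instance {
  student : finType;
  residency : finType;
  slist : student -> seq residency;
  rlist : residency -> seq student;
  slist_uniq : forall s, uniq (slist s);
  rlist_uniq : forall r, uniq (rlist r)
}.

(* [prefers l x y]: x comes strictly before y in the preference list l. *)
Definition prefers (T : eqType) (l : seq T) (x y : T) : bool :=
  [&& x \in l, y \in l & index x l < index y l].

Section Stability.
Variable I : instance.
Implicit Types (M : {set student I * residency I}).
Implicit Types (s : student I) (r : residency I).

Definition acceptable s r : bool := (r \in slist s) && (s \in rlist r).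

Definition is_matching M : bool :=
  [forall p in M, forall q in M, ((p.1 == q.1) || (p.2 == q.2)) ==> (p == q)].

Definition student_would_switch M s r : bool :=
  [forall r', (s, r') \notin M]
  || [exists r', ((s, r') \in M) && prefers (slist s) r r'].

Definition residency_would_switch M s r : bool :=
  [forall s', (s', r) \notin M]
  || [exists s', ((s', r) \in M) && prefers (rlist r) s s'].

Definition blocking M s r : bool :=
  [&& acceptable s r, (s, r) \notin M,
      student_would_switch M s r & residency_would_switch M s r].

Definition stable M : bool :=
  [&& is_matching M,
      [forall p in M, acceptable p.1 p.2]
    & [forall s, forall r, ~~ blocking M s r]].

Definition stably_matchable s r : bool :=
  [exists M, stable M && ((s, r) \in M)].

Definition stably_matchable_graph : rel (student I + residency I) :=
  fun u v =>
    match u, v with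
    | inl s, inr r => stably_matchable s r
    | inr r, inl s => stably_matchable s r
    | _, _ => false
    end.

End Stability.

Definition graph_isomorphic (T U : finType) (e : rel T) (f : rel U) : Prop :=
  exists2 h : T -> U, bijective h & forall x y, e x y = f (h x) (h y).

Definition is_graph_of_stably_matchable_pairs (T : finType) (e : rel T) : Prop :=
  exists I : instance, graph_isomorphic e (stably_matchable_graph (I := I)).

Section Grid.
Local Open Scope ring_scope.

(* Integer points have real algebraic Euclidean distances. *)
Definition euclidean_dist (u v : nat * nat) : realalg :=
  Num.sqrt ((u.1%:R - v.1%:R) ^+ 2 + (u.2%:R - v.2%:R) ^+ 2).

Definition grid_graph (a b : nat) : rel ('I_a * 'I_b) :=
  fun u v => euclidean_dist (val u.1, val u.2) (val v.1, val v.2) == 1.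

End Grid.

(* Main.v *)
Require Import Defs.
From mathcomp Require Import all_boot all_order all_algebra realalg.
From mathcomp Require Import zify.

(* Sufficiency: if perfect matchings M_0, ..., M_(T-1) of a bipartite graph cover
   all edges and each edge occurs in a contiguous run of them, then letting one
   side prefer early edges and the other late ones makes every M_k stable. For the
   grids, such a sequence of length 5 is periodic away from the boundary, except
   that an odd side needs three exceptional last rows; 3 x 2 is done apart.

   Necessity: all stable matchings cover the same vertices, so a * b is even; and
   if s and r are partners in M, then s prefers M to N exactly when r prefers N to
   M. In the 3 x b grid write t, m, b for the rows and orient all preferences by
   time, from student-optimal to residency-optimal. Say t0 is matched first to m0,
   then to t1. Then m0 is matched to t0, m1, b0 in this order. Edges at t1 other
   than t0t1 live before m0m1, edges at b1 other than b0b1 live after it. If m1m2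
   is after m0m1, then m1 is always matched to t1 before m0m1, leaving no time for
   t1t2; otherwise the same happens to b1b2. *)

Set Implicit Arguments.
Unset Strict Implicit.
Unset Printing Implicit Defensive.

(** * Chains of perfect matchings *)

Section MatchingChain.

Variables (V : finType) (e : rel V) (c : pred V) (T : nat) (p : nat -> V -> V).
Hypothesis e_bip : forall x y, e x y -> c x != c y.
Hypothesis e_sym : symmetric e.
Hypothesis p_edge : forall k x, k < T -> e x (p k x).
Hypothesis p_inv : forall k x, k < T -> p k (p k x) = x.
Hypothesis p_onto : forall x y, e x y -> exists2 k, k < T & p k x = y.
Hypothesis p_run : forall i j k x,
  i <= j -> j <= k -> k < T -> p i x = p k x -> p j x = p k x.

(** The value is [T] when [x] and [y] are never partners. *)
Let first x y := find (fun k => p k x == y) (iota 0 T).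

Let first_le k x y : k < T -> p k x = y -> first x y <= k.
Proof.
move=> kT pk; rewrite leqNgt; apply/negP => lt.
by have := before_find 0 lt; rewrite nth_iota // pk eqxx.
Qed.

Let first_lt x y : e x y -> first x y < T.
Proof.
by case/p_onto => k kT pk; apply: leq_ltn_trans (first_le kT pk) kT.
Qed.

Let p_first x y : e x y -> p (first x y) x = y.
Proof.
move=> exy; have lt := first_lt exy.
have h : has (fun k => p k x == y) (iota 0 T) by rewrite has_find size_iota.
by have := nth_find 0 h; rewrite nth_iota // => /eqP.
Qed.

Let first_sym x y : e x y -> first x y = first y x.
Proof.
have le u v : e u v -> first u v <= first v u.
  move=> euv; have evu : e v u by rewrite e_sym.
  apply: first_le; first exact: first_lt.
  by have := p_inv v (first_lt evu); rewrite p_first.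
by move=> exy; apply/eqP; rewrite eqn_leq !le // e_sym.
Qed.

Let S := {x : V | c x}.
Let R := {x : V | ~~ c x}.

(** Among the neighbours of a vertex [first] is injective, since [p_first] recovers the neighbour;
    so these preorders have no ties on the lists sorted below. *)
Let by_early (s : S) : rel R := fun r r' => first (val s) (val r) <= first (val s) (val r').
Let by_late (r : R) : rel S := fun s s' => first (val r) (val s') <= first (val r) (val s).

Let sl (s : S) : seq R := sort (by_early s) (enum [pred r : R | e (val s) (val r)]).
Let rl (r : R) : seq S := sort (by_late r) (enum [pred s : S | e (val s) (val r)]).

Let sl_uniq s : uniq (sl s). Proof. by rewrite sort_uniq enum_uniq. Qed.
Let rl_uniq r : uniq (rl r). Proof. by rewrite sort_uniq enum_uniq. Qed.

Let I := Instance sl_uniq rl_uniq.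

Let mem_sl (s : S) (r : R) : (r \in sl s) = e (val s) (val r).
Proof. by rewrite mem_sort mem_enum. Qed.

Let mem_rl (s : S) (r : R) : (s \in rl r) = e (val s) (val r).
Proof. by rewrite mem_sort mem_enum. Qed.

Let prefers_sort (U : eqType) (le : rel U) (l : seq U) x y :
    total le -> transitive le -> x \in l -> y \in l -> ~~ le y x ->
  prefers (sort le l) x y.
Proof.
move=> tot tr xl yl; rewrite /prefers !mem_sort xl yl /= ltnNge.
have re : reflexive le by move=> u; have := tot u u; rewrite orbb.
apply: contra => le_ix; apply: (sorted_leq_index tr re (sort_sorted tot l)) le_ix.
  by rewrite mem_sort.
by rewrite mem_sort.
Qed.

Let stage k : {set student I * residency I} := [set q : S * R | p k (val q.1) == val q.2].

Let stage_edge k (s : S) (r : R) : k < T -> p k (val s) = val r -> e (val s) (val r).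
Proof. by move=> kT <-; apply: p_edge. Qed.

Let early_prefers (s : S) (r r' : R) : e (val s) (val r) -> e (val s) (val r') ->
  first (val s) (val r) < first (val s) (val r') -> prefers (sl s) r r'.
Proof.
move=> er er' lt; apply: prefers_sort; rewrite ?mem_enum ?inE //; last by rewrite -ltnNge.
  by move=> u v; apply: leq_total.
by move=> v u w; apply: leq_trans.
Qed.

Let late_prefers (r : R) (s s' : S) : e (val s) (val r) -> e (val s') (val r) ->
  first (val r) (val s') < first (val r) (val s) -> prefers (rl r) s s'.
Proof.
move=> es es' lt; apply: prefers_sort; rewrite ?mem_enum ?inE //; last by rewrite -ltnNge.
  by move=> u v; apply: leq_total.
by move=> v u w le1 le2; apply: leq_trans le2 le1.
Qed.

Let mate_s k (s : S) : k < T -> exists r : R, p k (val s) = val r.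
Proof.
move=> kT; have cs : ~~ c (p k (val s)).
  by have := e_bip (p_edge (val s) kT); rewrite (valP s); case: (c _).
by exists (exist (fun x => ~~ c x) _ cs).
Qed.

Let mate_r k (r : R) : k < T -> exists s : S, p k (val r) = val s.
Proof.
move=> kT; have cr : c (p k (val r)).
  by have := e_bip (p_edge (val r) kT); rewrite (negPf (valP r)); case: (c _).
by exists (exist (fun x => c x) _ cr).
Qed.

(** An edge outside stage [k] first appears either after [k], and then its student prefers the
    partner held at [k], or before [k], and then its residency does. The second case needs
    [p_run]. *)
Let stage_stable k : k < T -> stable (stage k).
Proof.
move=> kT; apply/and3P; split.
- apply/forall_inP=> [[s r]]; rewrite inE => /eqP /= sr.
  apply/forall_inP=> [[s' r']]; rewrite inE => /eqP /= sr'.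
  apply/implyP=> /orP[/eqP /= es|/eqP /= er].
    by rewrite -es sr in sr' *; rewrite (val_inj sr').
  apply/eqP; congr pair => //; apply: val_inj.
  by rewrite -(p_inv (val s) kT) -(p_inv (val s') kT) sr sr' er.
- apply/forall_inP=> [[s r]]; rewrite inE => /eqP /= sr.
  by rewrite /acceptable mem_sl mem_rl (stage_edge kT sr).
apply/forallP=> s; apply/forallP=> r; apply/negP.
case/and4P=> /andP[+ _] nsr; rewrite mem_sl => esr.
have ers : e (val r) (val s) by rewrite e_sym.
have tk : first (val s) (val r) != k.
  by apply: contraNneq nsr => <-; rewrite inE p_first.
case/orP=> [/forallP no|/existsP[r' /andP[]]].
  by have [r0 sr0] := mate_s s kT; have := no r0; rewrite inE sr0 eqxx.
rewrite inE => /eqP /= sr' /and3P[_ _ lt_r].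
case/orP=> [/forallP no|/existsP[s' /andP[]]].
  by have [s0 rs0] := mate_r r kT; have := no s0; rewrite inE -rs0 p_inv ?eqxx.
rewrite inE => /eqP /= s'r /and3P[_ _ lt_s].
have es' := stage_edge kT s'r; have er' := stage_edge kT sr'.
have es's : p k (val r) = val s' by rewrite -(p_inv (val s') kT) s'r.
have := tk; rewrite neq_ltn => /orP[lt|lt]; last first.
  have /early_prefers : first (val s) (val r') < first (val s) (val r).
    by apply: leq_ltn_trans lt; apply: first_le.
  by move=> /(_ er' esr) /and3P[_ _]; rewrite ltnNge ltnW.
have /late_prefers : first (val r) (val s) < first (val r) (val s').
  (* If [r] first met [s'] no later than [s], the run of [s'] up to stage [k] would cover the first
     meeting with [s], forcing [s = s']. *)
  rewrite ltnNge -(first_sym esr); apply/negP => le.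
  have p_late : p (first (val r) (val s')) (val r) = p k (val r).
    by rewrite p_first // e_sym.
  have := p_run le (ltnW lt) kT p_late; rewrite (first_sym esr) p_first // => eq_s.
  by case/negP: nsr; rewrite inE /= {1}eq_s p_inv.
by move=> /(_ es' esr) /and3P[_ _]; rewrite ltnNge ltnW.
Qed.

(** Acceptable pairs are exactly the edges, so no other pair is stably matchable; conversely every
    edge lies in some stage. *)
Lemma matching_chain_stably_matchable : is_graph_of_stably_matchable_pairs e.
Proof.
exists I.
have matchable (s : S) (r : R) : stably_matchable (I := I) s r = e (val s) (val r).
  apply/existsP/idP => [[M /andP[/and3P[_ /forall_inP acc _] /acc /andP[/= + _]]]|/p_onto[k kT sr]].
    by rewrite mem_sl.
  by exists (stage k); rewrite stage_stable //= inE sr.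
pose h x : S + R := match boolP (c x) with
  | AltTrue cx => inl (exist (fun x => c x) x cx)
  | AltFalse cx => inr (exist (fun x => ~~ c x) x cx)
  end.
pose g (u : S + R) := match u with inl s => val s | inr r => val r end.
have hK : cancel h g by move=> x; rewrite /h; case: {-}_ / boolP.
have gK : cancel g h.
  case=> [[x cx]|[x cx]]; rewrite /h /=.
    by case: {-}_ / boolP => cx'; [congr inl; apply: val_inj | case/negP: (cx')].
  by case: {-}_ / boolP => cx'; [case/negP: (cx) | congr inr; apply: val_inj].
exists h; first by exists g.
move=> x y; rewrite -{1}(hK x) -{1}(hK y).
case: (h x) (h y) => [s|r] [s'|r'] /=; rewrite ?matchable //.
- by apply/negP => /e_bip; rewrite (valP s) (valP s').
- by apply/negP => /e_bip; rewrite (negPf (valP r)) (negPf (valP r')).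
Qed.

End MatchingChain.

(** * Grids *)

Definition unit_apart (u v : nat * nat) : bool :=
     (u.1 == v.1) && ((u.2.+1 == v.2) || (v.2.+1 == u.2))
  || (u.2 == v.2) && ((u.1.+1 == v.1) || (v.1.+1 == u.1)).

Section EuclideanDistance.
Import Order.TTheory GRing.Theory Num.Theory.
Local Open Scope ring_scope.

(** On the right one of the two truncated differences is zero, so their sum is the absolute
    difference. *)
Lemma sqr_natr_sub (m n : nat) :
  (m%:R - n%:R) ^+ 2 = ((m - n + (n - m)) ^ 2)%N%:R :> realalg.
Proof.
wlog le_mn : m n / (m <= n)%N => [hw|].
  case/orP: (leq_total m n) => [|/hw E]; first exact: hw.
  by rewrite -opprB sqrrN E addnC.
by rewrite -opprB sqrrN -natrB // -natrX (eqP le_mn).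
Qed.

Lemma euclidean_dist_eq1 (u v : nat * nat) :
  (euclidean_dist u v == 1) = unit_apart u v.
Proof.
rewrite /euclidean_dist !sqr_natr_sub -natrD.
have -> (d : nat) : (Num.sqrt (d%:R : realalg) == 1) = (d == 1%N).
  apply/eqP/eqP => [sq|->]; last exact: sqrtr1.
  have := sqr_sqrtr (ler0n realalg d); rewrite sq expr1n => /eqP.
  by rewrite eq_sym pnatr_eq1 => /eqP.
rewrite /unit_apart; case: u v => [i j] [i' j'] /=.
nia.
Qed.

End EuclideanDistance.

Lemma grid_graphE a b (u v : 'I_a * 'I_b) :
  grid_graph u v = unit_apart (val u.1, val u.2) (val v.1, val v.2).
Proof. exact: euclidean_dist_eq1. Qed.

Lemma grid_graph_sym a b : symmetric (grid_graph (a := a) (b := b)).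
Proof. by move=> u v; rewrite !grid_graphE /unit_apart /=; lia. Qed.

Lemma grid_graph_parity a b (u v : 'I_a * 'I_b) :
  grid_graph u v -> odd (u.1 + u.2) != odd (v.1 + v.2).
Proof. by rewrite grid_graphE /unit_apart /=; lia. Qed.

Lemma grid_graph_transpose a b :
  is_graph_of_stably_matchable_pairs (grid_graph (a := a) (b := b)) ->
  is_graph_of_stably_matchable_pairs (grid_graph (a := b) (b := a)).
Proof.
case=> I [h bij_h eh]; exists I; exists (h \o (fun u => (u.2, u.1))).
  by apply: bij_comp => //; exists (fun u => (u.2, u.1)) => -[].
by move=> u v; rewrite -eh !grid_graphE /unit_apart /= orbC.
Qed.

(** * Chains of grid matchings described by directions and finite tables *)

Section DirectionTables.

(* A grid direction is a pair: is it along the second coordinate, and is it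
   increasing. *)
Local Notation U := (false, false).
Local Notation D := (false, true).
Local Notation L := (true, false).
Local Notation R := (true, true).

Definition move (d : bool * bool) (u : nat * nat) : nat * nat :=
  if d.1 then (u.1, if d.2 then u.2.+1 else u.2.-1)
  else (if d.2 then u.1.+1 else u.1.-1, u.2).

Section GridDirections.

Variables (a b T : nat) (dir : nat -> nat -> nat -> bool * bool).
Hypothesis dir_U : forall k i j, k < T -> i < a -> j < b -> dir k i j = U -> 0 < i.
Hypothesis dir_D : forall k i j, k < T -> i < a -> j < b -> dir k i j = D -> i.+1 < a.
Hypothesis dir_L : forall k i j, k < T -> i < a -> j < b -> dir k i j = L -> 0 < j.
Hypothesis dir_R : forall k i j, k < T -> i < a -> j < b -> dir k i j = R -> j.+1 < b.
Hypothesis dir_DU : forall k i j, k < T -> i.+1 < a -> j < b ->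
  (dir k i j == D) = (dir k i.+1 j == U).
Hypothesis dir_RL : forall k i j, k < T -> i < a -> j.+1 < b ->
  (dir k i j == R) = (dir k i j.+1 == L).
Hypothesis onto_D : forall i j, i.+1 < a -> j < b -> exists2 k, k < T & dir k i j = D.
Hypothesis onto_R : forall i j, i < a -> j.+1 < b -> exists2 k, k < T & dir k i j = R.
Hypothesis dir_run : forall x y z i j, x <= y -> y <= z -> z < T -> i < a -> j < b ->
  dir x i j = dir z i j -> dir y i j = dir z i j.

(** [insubd] falls back to the coordinate of [v] when a move leaves the grid; for [k < T] the first
    four hypotheses exclude this. *)
Let p k (v : 'I_a * 'I_b) : 'I_a * 'I_b :=
  let w := move (dir k v.1 v.2) (val v.1, val v.2) in (insubd v.1 w.1, insubd v.2 w.2).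

Let pE k v : k < T ->
  (val (p k v).1, val (p k v).2) = move (dir k v.1 v.2) (val v.1, val v.2).
Proof.
case: v => i j kT; rewrite /p !val_insubd /move /=.
have iU := dir_U kT (ltn_ord i) (ltn_ord j).
have iD := dir_D kT (ltn_ord i) (ltn_ord j).
have iL := dir_L kT (ltn_ord i) (ltn_ord j).
have iR := dir_R kT (ltn_ord i) (ltn_ord j).
have lt_i := ltn_ord i; have lt_j := ltn_ord j.
case: (dir k i j) iU iD iL iR => -[] [] /= iU iD iL iR; rewrite ?lt_i ?lt_j ?iD ?iR //.
  by rewrite (leq_ltn_trans (leq_pred _)).
by rewrite (leq_ltn_trans (leq_pred _)).
Qed.

Let pair_val_inj (u v : 'I_a * 'I_b) :
  (val u.1, val u.2) = (val v.1, val v.2) -> u = v.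
Proof. by case: u v => i j [i' j'] [/val_inj -> /val_inj ->]. Qed.

Lemma grid_directions_stably_matchable :
  is_graph_of_stably_matchable_pairs (grid_graph (a := a) (b := b)).
Proof.
apply: (@matching_chain_stably_matchable _ _ (fun v : 'I_a * 'I_b => odd (v.1 + v.2)) T p).
- exact: grid_graph_parity.
- exact: grid_graph_sym.
- move=> k [i j] kT; rewrite grid_graphE pE // /move /unit_apart /=.
  have := dir_U kT (ltn_ord i) (ltn_ord j).
  have := dir_L kT (ltn_ord i) (ltn_ord j).
  by case: (dir k i j) => -[] [] /= hL hU; try have := hL erefl; try have := hU erefl; lia.
- move=> k [i j] kT; apply: pair_val_inj; rewrite pE //.
  have := pE (i, j) kT; case: (p k (i, j)) => i' j' /=.
  have lt_i' := ltn_ord i'; have lt_j' := ltn_ord j'.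
  have := dir_U kT (ltn_ord i) (ltn_ord j).
  have := dir_L kT (ltn_ord i) (ltn_ord j).
  case E: (dir k i j) => [[] []] /=; rewrite /move /= => iL iU [Ei Ej].
  + have : dir k i' j' == L by rewrite Ei Ej -dir_RL ?E // -Ej.
    by move/eqP->; rewrite /= Ei Ej.
  + have j_gt0 := iL erefl.
    have : dir k i' j' == R by rewrite Ei Ej dir_RL ?prednK ?E.
    by move/eqP->; rewrite /= Ei Ej prednK.
  + have : dir k i' j' == U by rewrite Ei Ej -dir_DU ?E // -Ei.
    by move/eqP->; rewrite /= Ei Ej.
  + have i_gt0 := iU erefl.
    have : dir k i' j' == D by rewrite Ei Ej dir_DU ?prednK ?E.
    by move/eqP->; rewrite /= Ei Ej prednK.
- move=> u v uv.
  suff [k kT Ek] : exists2 k, k < T & move (dir k u.1 u.2) (val u.1, val u.2) = (val v.1, val v.2).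
    by exists k => //; apply: pair_val_inj; rewrite pE.
  case: u v uv => i j [i' j']; rewrite grid_graphE /unit_apart /=.
  have lt_i' := ltn_ord i'; have lt_j' := ltn_ord j'.
  have lt_i := ltn_ord i; have lt_j := ltn_ord j.
  case/orP=> /andP[/eqP E /orP[]/eqP E'].
  + have [|k kT Ek] := @onto_R i j lt_i; first by rewrite E'.
    by exists k => //; rewrite Ek /move /= E E'.
  + have [|k kT Ek] := @onto_R i j' lt_i; first by rewrite E'.
    exists k => //; have /eqP-> : dir k i j == L by rewrite -E' -dir_RL ?E' ?Ek.
    by rewrite /move /= E -E'.
  + have [||k kT Ek] := @onto_D i j; rewrite ?E' //.
    by exists k => //; rewrite Ek /move /= E E'.
  + have [||k kT Ek] := @onto_D i' j; rewrite ?E' //.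
    exists k => //; have /eqP-> : dir k i j == U by rewrite -E' -dir_DU ?E' ?Ek.
    by rewrite /move /= E -E'.
- move=> x y z [i j] xy yz zT Exz.
  have yT := leq_ltn_trans yz zT; have xT := leq_ltn_trans xy yT.
  apply: pair_val_inj; rewrite !pE //; congr move => /=.
  apply: (dir_run xy yz zT) => //.
  (* Moves that stay in the grid in distinct directions reach distinct points, so equal partners
     mean equal directions. *)
  have := pE (i, j) xT; rewrite Exz pE //=.
  have := dir_U xT (ltn_ord i) (ltn_ord j).
  have := dir_L xT (ltn_ord i) (ltn_ord j).
  have := dir_U zT (ltn_ord i) (ltn_ord j).
  have := dir_L zT (ltn_ord i) (ltn_ord j).
  rewrite /move; case: (dir x i j) => -[] []; case: (dir z i j) => -[] [] //=;
  by move=> zL zU xL xU []; try have := zL erefl; try have := zU erefl;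
     try have := xL erefl; try have := xU erefl; lia.
Qed.

End GridDirections.

(* A table lists, for each row class and each column class, the successive
   directions of the partners of the grid points of these classes. *)
Definition entry (W : seq (seq (seq (bool * bool)))) (c d k : nat) : bool * bool :=
  nth R (nth [::] (nth [::] W c) d) k.

(* The indices [i < n] are coarsened to classes [f i < m], and [S] lists the
   allowed pairs of consecutive classes; a class can be last (resp. first) only if
   it is no source (resp. target) of [S]. *)
Definition walk (S : seq (nat * nat)) (m n : nat) (f : nat -> nat) : Prop :=
  forall i, i < n ->
  [/\ f i < m, i.+1 < n -> (f i, f i.+1) \in S,
      f i \in unzip1 S -> i.+1 < n & f i \in unzip2 S -> 0 < i].

(** A computable form of the hypotheses on directions. The first block treats single cells:
    directions point only where a walk must continue, and each fills a contiguous run of stages. The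
    other two treat steps: both cells agree on when they are partners, and they are partners at
    least once. *)
Definition coherent (W : seq (seq (seq (bool * bool)))) (SA SB : seq (nat * nat))
    (m n T : nat) : bool :=
  [&& all (fun c => all (fun d => all (fun z =>
        [&& (entry W c d z == U) ==> (c \in unzip2 SA),
            (entry W c d z == D) ==> (c \in unzip1 SA),
            (entry W c d z == L) ==> (d \in unzip2 SB),
            (entry W c d z == R) ==> (d \in unzip1 SB)
          & all (fun y => all (fun x =>
              (entry W c d x == entry W c d z) ==> (entry W c d y == entry W c d z))
              (iota 0 y.+1)) (iota 0 z.+1)]) (iota 0 T)) (iota 0 n)) (iota 0 m),
      all (fun s => all (fun d =>
        has (fun k => entry W s.1 d k == D) (iota 0 T) &&
        all (fun k => (entry W s.1 d k == D) == (entry W s.2 d k == U)) (iota 0 T))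
        (iota 0 n)) SA
    & all (fun s => all (fun c =>
        has (fun k => entry W c s.1 k == R) (iota 0 T) &&
        all (fun k => (entry W c s.1 k == R) == (entry W c s.2 k == L)) (iota 0 T))
        (iota 0 m)) SB].

(** Each hypothesis on directions concerns one cell or two adjacent cells, hence one pair of classes
    or one step; so a single finite check serves grids of all sizes. *)
Lemma coherent_stably_matchable W SA SB m n T a b f g :
  coherent W SA SB m n T -> walk SA m a f -> walk SB n b g ->
  is_graph_of_stably_matchable_pairs (grid_graph (a := a) (b := b)).
Proof.
case/and3P=> /allP cW /allP cA /allP cB fA gB.
have cell k i j : k < T -> i < a -> j < b ->
    [/\ entry W (f i) (g j) k = U -> 0 < i, entry W (f i) (g j) k = D -> i.+1 < a,
        entry W (f i) (g j) k = L -> 0 < j, entry W (f i) (g j) k = R -> j.+1 < b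
      & forall x y, x <= y -> y <= k -> entry W (f i) (g j) x = entry W (f i) (g j) k ->
        entry W (f i) (g j) y = entry W (f i) (g j) k].
  move=> kT ia jb; have [fi _ fi1 fi2] := fA i ia; have [gj _ gj1 gj2] := gB j jb.
  have := cW (f i); rewrite mem_iota => /(_ fi) /allP /(_ (g j)).
  rewrite mem_iota => /(_ gj) /allP /(_ k); rewrite mem_iota => /(_ kT).
  case/and5P=> /implyP iU /implyP iD /implyP iL /implyP iR /allP run.
  split=> [/eqP/iU|/eqP/iD|/eqP/iL|/eqP/iR|x y xy yk /eqP Exk] //.
  have := run y; rewrite mem_iota ltnS => /(_ yk) /allP /(_ x).
  by rewrite mem_iota ltnS => /(_ xy) /implyP /(_ Exk) /eqP.
have vert i j : i.+1 < a -> j < b ->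
    (exists2 k, k < T & entry W (f i) (g j) k = D) /\
    forall k, k < T -> (entry W (f i) (g j) k == D) = (entry W (f i.+1) (g j) k == U).
  move=> ia jb; have [_ fi _ _] := fA i (ltnW ia); have [gj _ _ _] := gB j jb.
  have := cA _ (fi ia) => /allP /(_ (g j)); rewrite mem_iota => /(_ gj).
  case/andP=> /hasP[k + /eqP Ek] /allP E; rewrite mem_iota => kT.
  split=> [|l lT]; first by exists k.
  by have := E l; rewrite mem_iota => /(_ lT) /eqP.
have horiz i j : i < a -> j.+1 < b ->
    (exists2 k, k < T & entry W (f i) (g j) k = R) /\
    forall k, k < T -> (entry W (f i) (g j) k == R) = (entry W (f i) (g j.+1) k == L).
  move=> ia jb; have [fi _ _ _] := fA i ia; have [_ gj _ _] := gB j (ltnW jb).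
  have := cB _ (gj jb) => /allP /(_ (f i)); rewrite mem_iota => /(_ fi).
  case/andP=> /hasP[k + /eqP Ek] /allP E; rewrite mem_iota => kT.
  split=> [|l lT]; first by exists k.
  by have := E l; rewrite mem_iota => /(_ lT) /eqP.
apply: (@grid_directions_stably_matchable a b T (fun k i j => entry W (f i) (g j) k)).
- by move=> k i j kT ia jb; case: (cell k i j kT ia jb).
- by move=> k i j kT ia jb; case: (cell k i j kT ia jb).
- by move=> k i j kT ia jb; case: (cell k i j kT ia jb).
- by move=> k i j kT ia jb; case: (cell k i j kT ia jb).
- by move=> k i j kT ia jb; apply: (vert i j ia jb).2.
- by move=> k i j kT ia jb; apply: (horiz i j ia jb).2.
- by move=> i j ia jb; apply: (vert i j ia jb).1.
- by move=> i j ia jb; apply: (horiz i j ia jb).1.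
by move=> x y z i j xy yz zT ia jb; case: (cell z i j zT ia jb) => _ _ _ _; apply.
Qed.

(** For evenly many rows, stage 0 is vertical on rows 0-1, 2-3, and so on; stage 2 is vertical on
    rows 1-2, 3-4, and so on, with horizontal first and last rows; stage 4 is horizontal on columns
    0-1, 2-3, and so on. At stages 1 and 3 the outer columns lag behind, which makes room for the
    horizontal edges on columns 1-2, 3-4, and so on: in the first and last rows at stage 1, in the
    other rows at stage 3. *)
Definition even_or_long_table : seq (seq (seq (bool * bool))) := [::
  [:: [:: D; D; R; R; R]; [:: D; R; L; L; L]; [:: D; L; R; R; R]; [:: D; D; L; L; L]];
  [:: [:: U; U; D; D; R]; [:: U; D; D; R; L]; [:: U; D; D; L; R]; [:: U; U; D; D; L]];
  [:: [:: D; D; U; U; R]; [:: D; U; U; R; L]; [:: D; U; U; L; R]; [:: D; D; U; U; L]];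
  [:: [:: U; U; R; R; R]; [:: U; R; L; L; L]; [:: U; L; R; R; R]; [:: U; U; L; L; L]];
  [:: [:: D; D; U; U; R]; [:: R; U; U; D; L]; [:: L; U; U; D; R]; [:: D; D; U; U; L]];
  [:: [:: U; U; R; D; D]; [:: R; R; L; U; D]; [:: L; L; R; U; D]; [:: U; U; L; D; D]];
  [:: [:: R; R; R; U; U]; [:: L; L; L; R; U]; [:: R; R; R; L; U]; [:: L; L; L; U; U]]].

(* Even lengths give the classes 0 (1 2)* 3, odd ones 0 1 (2 1)* 4 5 6. *)
Definition index_class (n i : nat) : nat :=
  if i == 0 then 0
  else if odd n && (n <= i + 3) then i + 7 - n
  else if ~~ odd n && (n == i.+1) then 3
  else if odd i then 1 else 2.

Definition even_steps := [:: (0, 1); (1, 2); (2, 1); (2, 3); (0, 3)].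
Definition all_steps := [:: (1, 4); (4, 5); (5, 6)] ++ even_steps.

(** For [a = 3] the row classes would be 0, 5, 6, and 0 to 5 is no step. The table has no column
    classes that end an odd length, hence [b] is even. *)
Lemma grid_stably_matchable_even_or_long a b :
  1 < a -> a <> 3 -> 1 < b -> ~~ odd b ->
  is_graph_of_stably_matchable_pairs (grid_graph (a := a) (b := b)).
Proof.
move=> a1 a3 b1 b_even.
have ok : coherent even_or_long_table all_steps even_steps 7 4 5 by vm_compute.
apply: (coherent_stably_matchable (f := index_class a) (g := index_class b) ok).
  move=> i ia; rewrite /index_class; split; rewrite ?inE /= ?xpair_eqE;
  repeat case: ifP => ?; lia.
move=> i ib; rewrite /index_class (negPf b_even) /=; split; rewrite ?inE /= ?xpair_eqE;
repeat case: ifP => ?; lia.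
Qed.

(** These are the three domino tilings of the rectangle, the one with three horizontal dominoes in
    the middle. *)
Definition three_two_table : seq (seq (seq (bool * bool))) := [::
  [:: [:: D; R; R]; [:: D; L; L]];
  [:: [:: U; R; D]; [:: U; L; D]];
  [:: [:: R; R; U]; [:: L; L; U]]].

Lemma grid_3_2_stably_matchable :
  is_graph_of_stably_matchable_pairs (grid_graph (a := 3) (b := 2)).
Proof.
have ok : coherent three_two_table [:: (0, 1); (1, 2)] [:: (0, 1)] 3 2 3 by vm_compute.
by apply: (coherent_stably_matchable (f := id) (g := id) ok);
   case=> [|[|[|]]]; split.
Qed.

End DirectionTables.

(** * Comparing stable matchings *)

Section TwoStableMatchings.

Variable I : instance.
Implicit Types (M N : {set student I * residency I}) (s : student I) (r : residency I).

Lemma prefers_total (T : eqType) (l : seq T) x y :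
  x \in l -> y \in l -> x != y -> prefers l x y = ~~ prefers l y x.
Proof.
move=> xl yl xy; rewrite /prefers xl yl /= -leqNgt ltn_neqAle andb_idl // => _.
by apply: contra xy => /eqP /index_inj ->.
Qed.

Lemma stable_student_inj M s r r' :
  stable M -> (s, r) \in M -> (s, r') \in M -> r = r'.
Proof.
case/and3P=> /forall_inP m _ _ /m /forall_inP h /h.
by rewrite eqxx => /eqP [].
Qed.

Lemma stable_residency_inj M s s' r :
  stable M -> (s, r) \in M -> (s', r) \in M -> s = s'.
Proof.
case/and3P=> /forall_inP m _ _ /m /forall_inP h /h.
by rewrite eqxx orbT => /eqP [].
Qed.

Lemma stable_slist M s r : stable M -> (s, r) \in M -> r \in slist s.
Proof. by case/and3P=> _ /forall_inP acc _ /acc /andP[]. Qed.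

Lemma stable_rlist M s r : stable M -> (s, r) \in M -> s \in rlist r.
Proof. by case/and3P=> _ /forall_inP acc _ /acc /andP[]. Qed.

Lemma stable_not_blocking M s r : stable M -> ~~ blocking M s r.
Proof. by case/and3P=> _ _ /forallP /(_ s) /forallP. Qed.

(** Being unmatched in [N] counts as wanting to switch, so the gains also detect who is matched in
    [M] only. *)
Definition student_gains M N := [set q in M :\: N | student_would_switch N q.1 q.2].
Definition residency_gains M N := [set q in M :\: N | residency_would_switch N q.1 q.2].

(** If [s] gains by its pair [(s, r)] of [M], this pair can fail to block [N] only because [r] has
    in [N] a student it prefers to [s]. *)
Lemma student_gains_residencies M N : stable M -> stable N ->
  snd @: student_gains M N \subset snd @: residency_gains N M.
Proof.
move=> sM sN; apply/subsetP => r0 /imsetP[[s r] + ->] /=.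
rewrite !inE => /andP[/andP[nsr sr] sw].
have := stable_not_blocking s r sN.
rewrite /blocking /acceptable (stable_slist sM sr) (stable_rlist sM sr) nsr sw /=.
rewrite negb_or negb_forall => /andP[/existsP[s'] /negPn s'r].
rewrite negb_exists => /forallP /(_ s'); rewrite s'r /= => npref.
have ss' : s != s' by apply: contraNneq nsr => ->.
apply/imsetP; exists (s', r) => //; rewrite !inE s'r /= andbT; apply/andP; split.
  by apply: contra ss' => s'rM; rewrite (stable_residency_inj sM sr s'rM).
apply/orP; right; apply/existsP; exists s; rewrite sr /= prefers_total //.
- exact: stable_rlist sN s'r.
- exact: stable_rlist sM sr.
by rewrite eq_sym.
Qed.

Lemma residency_gains_students M N : stable M -> stable N ->
  fst @: residency_gains M N \subset fst @: student_gains N M.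
Proof.
move=> sM sN; apply/subsetP => s0 /imsetP[[s r] + ->] /=.
rewrite !inE => /andP[/andP[nsr sr] sw].
have := stable_not_blocking s r sN.
rewrite /blocking /acceptable (stable_slist sM sr) (stable_rlist sM sr) nsr sw /= andbT.
rewrite negb_or negb_forall => /andP[/existsP[r'] /negPn sr'].
rewrite negb_exists => /forallP /(_ r'); rewrite sr' /= => npref.
have rr' : r != r' by apply: contraNneq nsr => ->.
apply/imsetP; exists (s, r') => //; rewrite !inE sr' /= andbT; apply/andP; split.
  by apply: contra rr' => sr'M; rewrite (stable_student_inj sM sr sr'M).
apply/orP; right; apply/existsP; exists r; rewrite sr /= prefers_total //.
- exact: stable_slist sN sr'.
- exact: stable_slist sM sr.
by rewrite eq_sym.
Qed.

Lemma card_gains_fst M (A : {set student I * residency I}) :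
  stable M -> A \subset M -> #|fst @: A| = #|A|.
Proof.
move=> sM /subsetP AM; apply: card_in_imset => [[s r]] [s' r'] /AM sr /AM + /= ss'.
by rewrite -ss' => sr'; rewrite (stable_student_inj sM sr sr').
Qed.

Lemma card_gains_snd M (A : {set student I * residency I}) :
  stable M -> A \subset M -> #|snd @: A| = #|A|.
Proof.
move=> sM /subsetP AM; apply: card_in_imset => [[s r]] [s' r'] /AM sr /AM + /= rr'.
by rewrite -rr' => sr'; rewrite (stable_residency_inj sM sr sr').
Qed.

(** Projections are injective on matchings, so the two inclusions bound the numbers of gaining pairs
    by each other; both are then equalities. *)
Lemma gainsE M N : stable M -> stable N ->
  fst @: student_gains M N = fst @: residency_gains N M /\
  snd @: student_gains M N = snd @: residency_gains N M.
Proof.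
move=> sM sN.
have sub_s : student_gains M N \subset M.
  by apply/subsetP => q; rewrite !inE => /andP[/andP[]].
have sub_r : residency_gains N M \subset N.
  by apply/subsetP => q; rewrite !inE => /andP[/andP[]].
have S := student_gains_residencies sM sN; have F := residency_gains_students sN sM.
have := subset_leq_card S; have := subset_leq_card F.
rewrite (card_gains_fst sM sub_s) (card_gains_fst sN sub_r) => le1.
rewrite (card_gains_snd sM sub_s) (card_gains_snd sN sub_r) => le2.
have E : #|student_gains M N| = #|residency_gains N M| by apply/eqP; rewrite eqn_leq le1 le2.
split; apply/eqP; last first.
  by rewrite eqEcard S (card_gains_snd sM sub_s) (card_gains_snd sN sub_r) E leqnn.
by rewrite eq_sym eqEcard F (card_gains_fst sM sub_s) (card_gains_fst sN sub_r) E leqnn.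
Qed.

(** Part of the rural hospitals theorem: a student matched only in [M] would gain, but by [gainsE]
    gaining students also have partners in [N]. *)
Lemma stable_student_matched M N s r : stable M -> stable N ->
  (s, r) \in M -> exists r', (s, r') \in N.
Proof.
move=> sM sN sr; have [/existsP //|/existsPn no] := boolP [exists r', (s, r') \in N].
have : s \in fst @: student_gains M N.
  apply/imsetP; exists (s, r); rewrite //= !inE no sr /=.
  by apply/orP; left; apply/forallP.
have [-> _] := gainsE sM sN => /imsetP[[s' r'] + /= ss'].
by rewrite !inE -ss' => /andP[/andP[_]]; rewrite (negPf (no r')).
Qed.

Lemma stable_residency_matched M N s r : stable M -> stable N ->
  (s, r) \in M -> exists s', (s', r) \in N.
Proof.
move=> sM sN sr; have [/existsP //|/existsPn no] := boolP [exists s', (s', r) \in N].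
have : r \in snd @: residency_gains M N.
  apply/imsetP; exists (s, r); rewrite //= !inE no sr /=.
  by apply/orP; left; apply/forallP.
have [_ <-] := gainsE sN sM => /imsetP[[s' r'] + /= rr'].
by rewrite !inE -rr' => /andP[/andP[_]]; rewrite (negPf (no s')).
Qed.

(** By [gainsE], [r] is the residency of a student's gain in [M] exactly when it gains itself in
    [N]; its partners [s] and [s'] are the only candidates for these pairs. *)
Lemma stable_opposition M N s s' r r' : stable M -> stable N ->
  (s, r) \in M -> (s, r') \in N -> (s', r) \in N -> r != r' ->
  prefers (slist s) r r' = prefers (rlist r) s' s.
Proof.
move=> sM sN sr sr' s'r rr'.
have nsr : (s, r) \notin N.
  by apply: contra rr' => srN; rewrite (stable_student_inj sN srN sr').
have ns'r : (s', r) \notin M.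
  apply/negP => s'rM; case/negP: nsr.
  by rewrite (stable_residency_inj sM sr s'rM).
have [_ E] := gainsE sM sN.
apply/idP/idP => pr.
  have : r \in snd @: student_gains M N.
    apply/imsetP; exists (s, r); rewrite //= !inE nsr sr /=.
    by apply/orP; right; apply/existsP; exists r'; rewrite sr'.
  rewrite E => /imsetP[[s1 r1] + /= rr1]; rewrite -{}rr1 {r1} !inE /=.
  case/andP=> /andP[_ s1r]; have <- := stable_residency_inj sN s'r s1r.
  case/orP=> [/forallP/(_ s)|/existsP[s2 /andP[s2r]]]; first by rewrite sr.
  by have <- := stable_residency_inj sM sr s2r.
have : r \in snd @: residency_gains N M.
  apply/imsetP; exists (s', r); rewrite //= !inE s'r ns'r /=.
  by apply/orP; right; apply/existsP; exists s; rewrite sr.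
rewrite -E => /imsetP[[s1 r1] + /= rr1]; rewrite -{}rr1 {r1} !inE /=.
case/andP=> /andP[_ s1r]; have <- := stable_residency_inj sM sr s1r.
case/orP=> [/forallP/(_ r')|/existsP[r2 /andP[sr2]]]; first by rewrite sr'.
by have <- := stable_student_inj sN sr' sr2.
Qed.

End TwoStableMatchings.

(* [later x y z] orders the neighbours of [x] in the direction from the
   student-optimal to the residency-optimal matching: [z] is worse than [y] for
   a student [x], better than [y] for a residency [x]. *)
Record opposed_matchings (V : finType) (e : rel V) (K : Type)
    (mate : K -> rel V) (later : V -> V -> V -> bool) : Prop := OpposedMatchings {
  mate_sym : forall k, symmetric (mate k);
  mate_inj : forall k x y z, mate k x y -> mate k x z -> y = z;
  mate_edge : forall k x y, mate k x y -> e x y;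
  edge_mate : forall x y, e x y -> exists k, mate k x y;
  mate_total : forall k x y, e x y -> exists z, mate k x z;
  later_total : forall x y z, e x y -> e x z -> y != z -> later x y z = ~~ later x z y;
  later_opposed : forall x y z w l, e x y -> mate l x z -> mate l y w -> z != y ->
    later x y z = later y x w }.

(** Reversing the order for residencies turns opposition into agreement: the two ends of an edge
    agree whether it comes before or after a stable matching that avoids it. *)
Lemma stably_matchable_opposed (V : finType) (e : rel V) :
  is_graph_of_stably_matchable_pairs e ->
  exists K (mate : K -> rel V) later, opposed_matchings e mate later.
Proof.
case=> I [h [g hK gK] eh].
pose K := {M : {set student I * residency I} | stable M}.
pose mate (k : K) (u v : student I + residency I) := match u, v with
  | inl s, inr r => (s, r) \in val k
  | inr r, inl s => (s, r) \in val k
  | _, _ => false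
  end.
pose later (x y z : student I + residency I) := match x, y, z with
  | inl s, inr r, inr r' => prefers (slist s) r r'
  | inr r, inl s, inl s' => prefers (rlist r) s' s
  | _, _, _ => false
  end.
exists K, (fun k x y => mate k (h x) (h y)), (fun x y z => later (h x) (h y) (h z)).
split.
- by move=> k x y; case: (h x) (h y) => [s|r] [s'|r'].
- move=> [M sM] x y z mxy mxz; apply: (can_inj hK); move: mxy mxz.
  case: (h x) (h y) (h z) => [s|r] [s1|r1] [s2|r2] //= m1 m2.
    by rewrite (stable_student_inj sM m1 m2).
  by rewrite (stable_residency_inj sM m1 m2).
- move=> [M sM] x y; rewrite eh; case: (h x) (h y) => [s|r] [s1|r1] //= m;
  by apply/existsP; exists M; rewrite sM m.
- move=> x y; rewrite eh; case: (h x) (h y) => [s|r] [s1|r1] //= /existsP[M /andP[sM m]];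
  by exists (exist _ M sM).
- move=> [N sN] x y; rewrite eh.
  have ex (u : student I + residency I) : mate (exist _ N sN) (h x) u ->
      exists z, mate (exist _ N sN) (h x) (h z) by exists (g u); rewrite gK.
  move: ex; case: (h x) (h y) => [s|r] [s1|r1] //= ex /existsP[M /andP[sM m]].
    by have [r' m'] := stable_student_matched sM sN m; apply: (ex (inr r')).
  by have [s' m'] := stable_residency_matched sM sN m; apply: (ex (inl s')).
- move=> x y z; rewrite !eh -(can_eq hK).
  case: (h x) (h y) (h z) => [s|r] [s1|r1] [s2|r2] //= /existsP[M /andP[sM m]]
    /existsP[N /andP[sN n]] yz; apply: prefers_total => //.
  + exact: stable_slist sM m.
  + exact: stable_slist sN n.
  + exact: stable_rlist sN n.
  + exact: stable_rlist sM m.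
  by rewrite eq_sym.
move=> x y z w [N sN]; rewrite eh -(can_eq hK).
case: (h x) (h y) (h z) (h w) => [s|r] [s1|r1] [s2|r2] [s3|r3] //=
  /existsP[M /andP[sM m]] n1 n2 zy.
  by apply: (stable_opposition sM sN m n1 n2); rewrite eq_sym.
apply/esym; apply: (stable_opposition sM sN m n2 n1).
apply: contraNneq zy => E; rewrite E in m.
by rewrite -E in n2; rewrite (stable_residency_inj sN n1 n2).
Qed.

(** * Necessity *)

(** Without isolated vertices any one of the matchings is perfect, and its partner map is an
    involution exchanging the two colour classes. *)
Lemma opposed_matchings_even (V : finType) (e : rel V) (c : pred V) K
    (mate : K -> rel V) later :
  opposed_matchings e mate later -> (forall x y, e x y -> c x != c y) ->
  (forall x, exists y, e x y) -> ~~ odd #|V|.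
Proof.
move=> sys bip deg.
have [->//|/card_gt0P[x0 _]] := posnP #|V|.
have [y0 /(edge_mate sys)[k _]] := deg x0.
have mateP x : exists y, mate k x y by have [y /(mate_total sys k)] := deg x.
pose f x := xchoose (mateP x).
have fP x : mate k x (f x) by apply: xchooseP.
have fK : involutive f.
  by move=> x; apply: (mate_inj sys (fP (f x))); rewrite (mate_sym sys).
have fc x : c (f x) = ~~ c x.
  by have := bip _ _ (mate_edge sys (fP x)); case: (c x) (c (f x)) => -[].
have E : #|[predC c]| = #|c|.
  rewrite -(card_image (inv_inj fK) c); apply: eq_card => x.
  have -> : (x \in image f c) = c (f x).
    by rewrite -{1}(fK x) mem_image //; apply: inv_inj.
  by rewrite fc.
by rewrite -(cardC c) E addnn odd_double.
Qed.

(** * The corner of a grid with three rows *)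

Section ThreeRowCorner.

Variables (V : finType) (e : rel V) (K : Type) (mate : K -> rel V) (v : nat -> V).
Hypothesis v_eq : forall i j, i < 9 -> j < 9 -> (v i == v j) = (i == j).

Local Notation t0 := (v 0).
Local Notation t1 := (v 1).
Local Notation t2 := (v 2).
Local Notation m0 := (v 3).
Local Notation m1 := (v 4).
Local Notation m2 := (v 5).
Local Notation b0 := (v 6).
Local Notation b1 := (v 7).
Local Notation b2 := (v 8).

Hypothesis e_t0 : forall x, e t0 x = (x \in [:: m0; t1]).
Hypothesis e_b0 : forall x, e b0 x = (x \in [:: m0; b1]).
Hypothesis e_m0 : forall x, e m0 x = (x \in [:: t0; b0; m1]).
Hypothesis e_m1 : forall x, e m1 x = (x \in [:: m0; t1; b1; m2]).
Hypothesis e_t1 : forall x, e t1 x = (x \in [:: t0; m1; t2]).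
Hypothesis e_b1 : forall x, e b1 x = (x \in [:: b0; m1; b2]).

Lemma corner_not_top_first later :
  opposed_matchings e mate later -> later t0 m0 t1 -> False.
Proof.
move=> sys t0_first.
have msym k x y : mate k x y -> mate k y x by rewrite (mate_sym sys).
have excl k x y z : mate k x y -> mate k x z -> y != z -> False.
  by move=> my mz; rewrite (mate_inj sys my mz) eqxx.
have corner_t k : mate k t0 m0 \/ mate k t0 t1.
  have [|z mz] := mate_total sys k (x := t0) (y := m0); first by rewrite e_t0 !inE eqxx.
  by have := mate_edge sys mz; rewrite e_t0 !inE => /orP[]/eqP E; rewrite -E; [left|right].
have corner_b k : mate k b0 m0 \/ mate k b0 b1.
  have [|z mz] := mate_total sys k (x := b0) (y := m0); first by rewrite e_b0 !inE eqxx.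
  by have := mate_edge sys mz; rewrite e_b0 !inE => /orP[]/eqP E; rewrite -E; [left|right].
(* A corner has only two possible partners, so taking one of them away forces the other. *)
have T1 k y : mate k t1 y -> y != t0 -> mate k m0 t0.
  by move=> my yt; case: (corner_t k) => /msym // /(excl _ _ _ _ my) /(_ yt).
have T0 k y : mate k m0 y -> y != t0 -> mate k t0 t1.
  by move=> my yt; case: (corner_t k) => // /msym /(excl _ _ _ _ my) /(_ yt).
have B1 k y : mate k b1 y -> y != b0 -> mate k m0 b0.
  by move=> my yt; case: (corner_b k) => /msym // /(excl _ _ _ _ my) /(_ yt).
have B0 k y : mate k m0 y -> y != b0 -> mate k b0 b1.
  by move=> my yt; case: (corner_b k) => // /msym /(excl _ _ _ _ my) /(_ yt).
(* Whenever [m0] has another partner, [t0] is with [t1], hence after [t0m0]; the other end [m0] must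
   agree. *)
have m0_first y : e m0 y -> y != t0 -> later m0 t0 y.
  move=> em yt; have [k my] := edge_mate sys em.
  rewrite -(later_opposed sys _ (T0 k y my yt) my) ?v_eq //.
  by rewrite e_t0 !inE eqxx.
have m0t0 : e m0 t0 by rewrite e_m0 !inE eqxx.
have m0b0 : e m0 b0 by rewrite e_m0 !inE eqxx orbT.
have m0m1 : e m0 m1 by rewrite e_m0 !inE eqxx !orbT.
have b0_last : later b0 m0 b1 = false.
  have [k my] := edge_mate sys m0t0.
  have mb : mate k b0 b1 by apply: B0 my _; rewrite v_eq.
  rewrite -(later_opposed sys m0b0 my mb) ?v_eq //.
  by rewrite (later_total sys) ?v_eq // m0_first ?v_eq.
have m0_last : later m0 m1 b0.
  have [k my] := edge_mate sys m0m1.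
  have mb : mate k b0 b1 by apply: B0 my _; rewrite v_eq.
  rewrite (later_total sys) ?v_eq //.
  by rewrite (later_opposed sys m0b0 my mb) ?v_eq // b0_last.
(* With [t1] away from [t0], [m0] is with [t0], so the matching precedes the edge [m0m1], also as
   seen from [m1]. *)
have top k y w : mate k t1 y -> y != t0 -> mate k m1 w -> later m1 m0 w = false.
  move=> my yt mw; rewrite -(later_opposed sys m0m1 (T1 k y my yt) mw) ?v_eq //.
  by rewrite (later_total sys) ?v_eq // m0_first ?v_eq.
have bot k y w : mate k b1 y -> y != b0 -> mate k m1 w -> later m1 m0 w.
  by move=> my yt mw; rewrite -(later_opposed sys m0m1 (B1 k y my yt) mw) ?v_eq.
have later_t1 : later m1 m0 t1 = false.
  have [|k my] := edge_mate sys (x := t1) (y := m1); first by rewrite e_t1 !inE eqxx orbT.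
  by apply: top my _ (msym _ _ _ my); rewrite v_eq.
have later_b1 : later m1 m0 b1.
  have [|k my] := edge_mate sys (x := b1) (y := m1); first by rewrite e_b1 !inE eqxx orbT.
  by apply: bot my _ (msym _ _ _ my); rewrite v_eq.
have m1m0 : e m1 m0 by rewrite e_m1 !inE eqxx.
(* In a matching with [t1t2], [m1] cannot have [m0] or [t1], and [b1] would come too late; so it has
   [m2]. *)
have later_m2 : later m1 m0 m2 = false.
  have [|k my] := edge_mate sys (x := t1) (y := t2); first by rewrite e_t1 !inE eqxx !orbT.
  have t2t0 : t2 != t0 by rewrite v_eq.
  have [w mw] := mate_total sys k m1m0; have := top _ _ _ my t2t0 mw.
  have := mate_edge sys mw; rewrite e_m1 !inE => /or4P[]/eqP E; rewrite {w}E // in mw *.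
  - by case: (excl _ _ _ _ (msym _ _ _ mw) (T1 _ _ my t2t0)); rewrite v_eq.
  - by case: (excl _ _ _ _ (msym _ _ _ mw) my); rewrite v_eq.
  - by rewrite later_b1.
(* In a matching with [b1b2], [m1] needs a partner later than [m0], but [m0] and [b1] are taken and
   [t1] and [m2] are too early. *)
have [|k my] := edge_mate sys (x := b1) (y := b2); first by rewrite e_b1 !inE eqxx !orbT.
have b2b0 : b2 != b0 by rewrite v_eq.
have [w mw] := mate_total sys k m1m0; have := bot _ _ _ my b2b0 mw.
have := mate_edge sys mw; rewrite e_m1 !inE => /or4P[]/eqP E; rewrite {w}E in mw *.
- by case: (excl _ _ _ _ (msym _ _ _ mw) (B1 _ _ my b2b0)); rewrite v_eq.
- by rewrite later_t1.
- by case: (excl _ _ _ _ (msym _ _ _ mw) my); rewrite v_eq.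
by rewrite later_m2.
Qed.

(** Time reversal, which exchanges the roles of students and residencies, allows the assumption that
    [t0] meets [m0] first. *)
Lemma opposed_matchings_reverse later :
  opposed_matchings e mate later ->
  opposed_matchings e mate (fun x y z => later x z y).
Proof.
case=> ms mi me em mt lt lo; split=> //.
  by move=> x y z xy xz yz; rewrite lt // eq_sym.
move=> x y z w l xy mz mw zy.
have yx : e y x by have [k] := em _ _ xy; rewrite ms => /me.
have xz := me _ _ _ mz; have yw := me _ _ _ mw.
have wx : w != x.
  by apply: contraNneq zy => wx; rewrite wx ms in mw; rewrite (mi _ _ _ _ mz mw).
by rewrite lt // (lt y w x) //; congr negb; apply: lo mz mw zy.
Qed.

Lemma corner_not_opposed later : opposed_matchings e mate later -> False.
Proof.
move=> sys; have [|not_first] := boolP (later t0 m0 t1).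
  exact: corner_not_top_first.
apply: (corner_not_top_first (opposed_matchings_reverse sys)).
by rewrite (later_total sys) ?v_eq ?e_t0 ?inE ?eqxx ?orbT.
Qed.

End ThreeRowCorner.

Lemma grid_3_not_stably_matchable b : 2 < b ->
  ~ is_graph_of_stably_matchable_pairs (grid_graph (a := 3) (b := b)).
Proof.
case: b => [|[|[|b]]] // _ /stably_matchable_opposed[K [mate [later sys]]].
(* The points of the leftmost 3 x 3 block, numbered row by row; all neighbours of its first two
   columns lie in the block. *)
pose v n : 'I_3 * 'I_b.+3 := (inord (n %/ 3), inord (n %% 3)).
have vE n x : n < 9 -> (x == v n) = (x.1 == n %/ 3 :> nat) && (x.2 == n %% 3 :> nat).
  by case: x => i j n9; rewrite xpair_eqE -!val_eqE /= !inordK //; lia.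
have v1 n : n < 9 -> val (v n).1 = n %/ 3 by move=> n9; rewrite /v /= inordK //; lia.
have v2 n : n < 9 -> val (v n).2 = n %% 3 by move=> n9; rewrite /v /= inordK //; lia.
apply: (@corner_not_opposed _ _ _ _ v _ _ _ _ _ _ _ _ sys).
  by move=> i j i9 j9; rewrite vE // v1 // v2 //; lia.
all: move=> x; rewrite grid_graphE !inE !vE // v1 // v2 // /unit_apart;
  case: x => [[i i3] j] /=; lia.
Qed.

Theorem theorem10 (a b : nat) (ha : 1 < a) (hb : 1 < b) :
  is_graph_of_stably_matchable_pairs (grid_graph (a := a) (b := b)) <->
  (~~ odd (a * b) /\ minn a b <> 3).
Proof.
split=> [grid|[ab_even min_ab]].
  split.
    have [K [mate [later sys]]] := stably_matchable_opposed grid.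
    have -> : a * b = #|{: 'I_a * 'I_b}| by rewrite card_prod !card_ord.
    apply: (opposed_matchings_even (c := fun u : 'I_a * 'I_b => odd (u.1 + u.2)) sys).
      exact: grid_graph_parity.
    move=> [i j]; have [k kb kj] : exists2 k, k < b & unit_apart (val i, val j) (val i, k).
      have := ltn_ord j; rewrite /unit_apart /= eqxx /=.
      case: (posnP j) => [->|j0] jb; first by exists 1.
      by exists j.-1; lia.
    by exists (i, Ordinal kb); rewrite grid_graphE.
  move=> min3; have [a3|b3] : a = 3 \/ b = 3 by lia.
    by move: grid; rewrite a3; apply: grid_3_not_stably_matchable; lia.
  move/grid_graph_transpose: grid; rewrite b3.
  by apply: grid_3_not_stably_matchable; lia.
(* Up to transposition the second side is even; if the first is 3, the condition on the minimum
   leaves only 2 for the second. *)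
have main c d : 1 < c -> 1 < d -> minn c d <> 3 -> ~~ odd d ->
    is_graph_of_stably_matchable_pairs (grid_graph (a := c) (b := d)).
  move=> c1 d1 min_cd d_even; have [c3|c3] := eqVneq c 3; last first.
    by apply: grid_stably_matchable_even_or_long => //; apply/eqP.
  have d2 : d = 2 by lia.
  by rewrite c3 d2; apply: grid_3_2_stably_matchable.
move: ab_even; rewrite oddM negb_and => /orP[a_even|]; last exact: main.
by apply: grid_graph_transpose; apply: main; rewrite // minnC.
Qed.
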